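(* For any positive integer $k$, as $x\to\infty$, \[ \sum_{p_{1}\cdots p_{k}\leq x}\frac{1}{p_{1}\cdots p_{k}}=(\log_{2}x+B)^{k}+\sum_{m=2}^{k}C_{k}^{m}a_{m}(\log_{2}x+B)^{k-m}+O\left(\frac{(\log_{2}x)^{k-1}}{\log x}\right), \] where the sequence $(a_n)_{n\ge2}$ is given by $a_{2}=-\zeta(2)$, $a_{3}=2\zeta(3)$, $a_{4}=3\zeta(2)^{2}-6\zeta(4)$, and for $n>4$, \[ a_{n}=\sum_{i=1}^{n-3}(-1)^{i}C_{n-1}^{i}\,i!\,\zeta(i+1)\,a_{n-1-i}+(-1)^{n-1}(n-1)!\,\zeta(n). \]
   Context: Throughout, $p,p_1,p_2,\dots$ denote prime numbers, and $\sum_{p_1\cdots p_k\le x}$ denotes a sum over all ordered $k$-tuples $(p_1,\dots,p_k)$ of primes with $p_1\cdots p_k\le x$. $\log_2 x=\log(\log x)$. $B\approx 0.261$ is the Mertens constant, $B=\lim_{x\to\infty}\big(\sum_{p\le x}1/p-\log_2 x\big)$. $C_k^l=\binom{k}{l}$. $\zeta$ is the Riemann zeta function. An empty sum is $0$. *)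

(* Defs.v *)
From HB Require Import structures.
From mathcomp Require Import all_boot all_order all_algebra.
From mathcomp Require Import all_classical all_reals all_analysis.
From mathcomp Require Import zify.

Set Implicit Arguments.
Unset Strict Implicit.
Unset Printing Implicit Defensive.

Import Order.TTheory GRing.Theory Num.Theory.
Import numFieldNormedType.Exports.

Local Open Scope classical_set_scope.
Local Open Scope ring_scope.

(* The library declares no [filter_on] instance for +oo, which the notation
   [f = g +O_F h] requires. *)
Canonical pinfty_filter_on (R : numFieldType) :=
  FilterType (pinfty_nbhs R) _.

Section Definitions.
Variable R : realType.

Definition log2 (x : R) : R := ln (ln x).

Definition prime_tuples (k : nat) (x : R) : set (k.-tuple nat) :=
  [set p | all prime p /\ (\prod_(q <- p) q)%N%:R <= x].

(* [\sum_(_ \in A)] is only meaningful for finite supports; see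
   [finite_prime_tuples] and [finite_primes_le] below. *)
Definition prime_tuple_sum (k : nat) (x : R) : R :=
  \sum_(p \in @prime_tuples k x) ((\prod_(q <- p) q)%N%:R : R)^-1.

Definition primes_le (x : R) : set nat := [set p | prime p /\ p%:R <= x].

Definition mertens_B : R :=
  lim ((\sum_(p \in primes_le x) (p%:R : R)^-1 - log2 x) @[x --> +oo]).

(* Only evaluated at integers n >= 2, where zeta is the sum of its Dirichlet
   series; [riemannR s] is the sequence n |-> 1 / (n + 1) `^ s. *)
Definition zeta (s : R) : R := limn (series (riemannR s)).

(* The values a 0 and a 1 are unconstrained. *)
Definition coef_seq (a : nat -> R) : Prop :=
  [/\ a 2 = - zeta 2,
      a 3 = 2 * zeta 3,
      a 4 = 3 * zeta 2 ^+ 2 - 6 * zeta 4 &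
      forall n : nat, (4 < n)%N ->
        a n = \sum_(1 <= i < n.-2)
                (-1) ^+ i * 'C(n.-1, i)%:R * i`!%:R * zeta i.+1%:R
                  * a (n.-1 - i)%N
              + (-1) ^+ n.-1 * n.-1`!%:R * zeta n%:R].

End Definitions.

Section Sanity.
Variable R : realType.

Lemma finite_primes_le (x : R) : finite_set (primes_le x).
Proof.
apply: (@sub_finite_set _ _ `I_(Num.truncn x).+1); last exact: finite_II.
move=> p [_ px] /=.
by rewrite ltnS truncn_ge_nat// (le_trans _ px).
Qed.

Lemma finite_prime_tuples k (x : R) : finite_set (@prime_tuples R k x).
Proof.
pose N := (Num.truncn x).+1.
apply: (@sub_finite_set _ _
  ((fun t : k.-tuple 'I_N => map_tuple (@nat_of_ord N) t) @` setT)); last first.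
  exact/finite_image/finite_finset.
move=> p [/allP pp px].
have P0 : (0 < \prod_(q <- p) q)%N.
  by rewrite big_seq prodn_cond_gt0// => q /pp /prime_gt0.
have small q : q \in tval p -> (q < N)%N.
  move=> qp; rewrite ltnS truncn_ge_nat ?(le_trans _ px)//.
  by rewrite ler_nat dvdn_leq// (big_rem q)//= dvdn_mulr.
exists (map_tuple (@inord _) p) => //.
apply/val_inj => /=; rewrite -map_comp -[RHS]map_id.
by apply/eq_in_map => q qp /=; rewrite inordK// small.
Qed.

Lemma coef_seq_exists : exists a : nat -> R, coef_seq a.
Proof.
pose step n (a : nat -> R) : R :=
  if n == 2 then - zeta 2 else if n == 3 then 2 * zeta 3 else
  if n == 4 then 3 * zeta 2 ^+ 2 - 6 * zeta 4 else
  \sum_(1 <= i < n.-2)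
     (-1) ^+ i * 'C(n.-1, i)%:R * i`!%:R * zeta i.+1%:R * a (n.-1 - i)%N
  + (-1) ^+ n.-1 * n.-1`!%:R * zeta n%:R.
pose l := fix l n := if n is m.+1 then rcons (l m) (step m (nth 0 (l m))) else [::].
have sl n : size (l n) = n by elim: n => //= n IH; rewrite size_rcons IH.
pose a n := nth 0 (l n.+1) n.
have nl m n : (m < n)%N -> nth 0 (l n) m = a m.
  elim: n => // n IH; rewrite ltnS leq_eqVlt => /orP[/eqP->//|mn].
  by rewrite /= nth_rcons sl mn IH.
have aE n : a n = step n (nth 0 (l n)).
  by rewrite /a /= nth_rcons sl ltnn eqxx.
exists a; split; try by rewrite aE.
move=> n n4; rewrite aE /step !gtn_eqF//; [|lia..].
congr (_ + _); apply: eq_big_nat => i /andP[i1 i2].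
by rewrite nl//; lia.
Qed.

End Sanity.

(* Main.v *)
Require Import Defs.
From mathcomp Require Import all_boot all_order all_algebra.
From mathcomp Require Import all_classical all_reals all_analysis.
From mathcomp Require Import ring lra zify.
Import Order.TTheory GRing.Theory Num.Theory.
Import numFieldNormedType.Exports.
Local Open Scope classical_set_scope.
Local Open Scope ring_scope.
Set Implicit Arguments.
Unset Strict Implicit.
Unset Printing Implicit Defensive.

(**
Sort the primes into buckets: p goes to u when u is within 1 of log p, and
w(u) is the sum of 1/p over the bucket u. Rounding the logarithms down or up
bounds the sum over p_1...p_k <= x, from above or below, by the N-th partial
sum of the k-fold Cauchy power of w, N = floor(log x). Mertens' second theorem
says that the partial sums of w agree up to O(1/n) with those of the model
weights c, 1, 1/2, 1/3, ... for a suitable c, and Cauchy products of sequences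
of size O(1/n) only lose a factor log n, so w may be replaced by the model.

The partial sums of the Cauchy powers of the model have the exact exponential
generating function exp(c z) (1 + z) (1 + z/2) ... (1 + z/N) in the exponent k.
Its logarithmic derivative yields a Newton identity in the power sums
1 + 2^-j + ... + N^-j = zeta(j) + O(1/N) (j >= 2) and
c + 1 + 1/2 + ... + 1/N = log_2 x + B + O(1/N). In the limit this is the
recursion satisfied by the polynomials on the right-hand side of the theorem,
and the two recursions are compared term by term.
*)

(** * Cauchy products *)

Section Convolution.
Variable R : comNzRingType.
Implicit Types (f g h : nat -> R).

Definition cprod f g (n : nat) : R := \sum_(i < n.+1) f i * g (n - i)%N.

(** Truncating both sequences to polynomials lets the algebra of Cauchy products be inherited from
    the polynomial ring. *)
Lemma cprod_coef f g n N : (n < N)%N ->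
  cprod f g n = ((\poly_(i < N) f i) * (\poly_(i < N) g i))`_n.
Proof.
move=> nN; rewrite coefM; apply: eq_bigr => i _.
have := ltn_ord i; rewrite ltnS => le_in.
by rewrite !coef_poly !ifT//; lia.
Qed.

Lemma cprod_ext f f' g g' n :
  (forall i, (i <= n)%N -> f i = f' i) -> (forall i, (i <= n)%N -> g i = g' i) ->
  cprod f g n = cprod f' g' n.
Proof.
move=> ff gg; apply: eq_bigr => i _; rewrite ff ?gg//; first exact: leq_subr.
by rewrite -ltnS.
Qed.

Lemma cprodC f g : cprod f g = cprod g f.
Proof.
by apply/funext => n; rewrite !(cprod_coef _ _ (ltnSn n)) mulrC.
Qed.

Lemma cprodA f g h : cprod f (cprod g h) = cprod (cprod f g) h.
Proof.
apply/funext => n; set N := n.+1.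
(* The coefficient of index n only sees coefficients below [N], so the inner product may be
   truncated or not. *)
have coef_trunc (p q : {poly R}) :
    ((\poly_(j < N) p`_j) * q)`_n = (p * q)`_n.
  rewrite !coefM; apply: eq_bigr => i _.
  by rewrite coef_poly (ltn_ord i).
transitivity ((\poly_(l < N) f l * (\poly_(l < N) g l * \poly_(l < N) h l))`_n).
  rewrite [X in _ = (polyseq X)`_n]mulrC -coef_trunc mulrC (@cprod_coef _ _ n N)//.
  congr ((_ * _ : {poly R})`_n); apply/polyP => i; rewrite !coef_poly; case: ifP => // iN.
  by rewrite (@cprod_coef _ _ _ N).
rewrite mulrA -coef_trunc (@cprod_coef _ _ n N)//; congr ((_ * _ : {poly R})`_n).
apply/polyP => i; rewrite !coef_poly; case: ifP => // iN.
by rewrite (@cprod_coef _ _ _ N).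
Qed.

Lemma cprodDl f f' g n : cprod (fun i => f i + f' i) g n = cprod f g n + cprod f' g n.
Proof. by rewrite -big_split; apply: eq_bigr => i _; rewrite mulrDl. Qed.

Lemma cprodBl f f' g n : cprod (fun i => f i - f' i) g n = cprod f g n - cprod f' g n.
Proof. by rewrite -sumrB; apply: eq_bigr => i _; rewrite mulrBl. Qed.

Lemma cprodZl a f g n : cprod (fun i => a * f i) g n = a * cprod f g n.
Proof. by rewrite mulr_sumr; apply: eq_bigr => i _; rewrite mulrA. Qed.

(* Multiplication by the index is z d/dz on generating series. *)
Lemma cprod_deriv f g n :
  n%:R * cprod f g n = cprod (fun i => i%:R * f i) g n + cprod f (fun i => i%:R * g i) n.
Proof.
rewrite mulr_sumr -big_split; apply: eq_bigr => i _ /=.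
have in_ : (i <= n)%N by rewrite -ltnS.
have -> : n%:R = i%:R + (n - i)%:R :> R by rewrite -natrD subnKC.
ring.
Qed.

Definition delta (n : nat) : R := (n == 0)%:R.

Lemma cprod_delta f : cprod delta f = f.
Proof.
apply/funext => n; rewrite /cprod big_ord_recl /= subn0 mul1r big1 ?addr0//.
by move=> i _; rewrite mul0r.
Qed.

Definition cpow f k := iter k (cprod f) delta.

Lemma cpowS f k : cpow f k.+1 = cprod f (cpow f k). Proof. by []. Qed.

(** The coefficients of 1/(1 - z): a Cauchy product with [ones] takes partial sums. *)
Definition ones (n : nat) : R := 1.

Lemma cprod_ones f n : cprod ones f n = \sum_(i < n.+1) f i.
Proof.
rewrite cprodC; by apply: eq_bigr => i _; rewrite mulr1.
Qed.

Lemma cprod_onesS f n : cprod ones f n.+1 = cprod ones f n + f n.+1.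
Proof. by rewrite !cprod_ones big_ord_recr. Qed.

(** The power rule for z d/dz: z (f^(k+1))' = (k+1) (z f') f^k. *)
Lemma cpow_deriv f k n : n%:R * cpow f k.+1 n =
  k.+1%:R * cprod (fun i => i%:R * f i) (cpow f k) n.
Proof.
elim: k n => [|k IH] n.
  by rewrite cpowS cprod_deriv mul1r -[X in _ + X]/(\sum_(i < n.+1) _)
    [X in _ + X]big1 ?addr0// => i _;
    rewrite /cpow /= /delta; case: eqP => [->|]; rewrite ?mul0r ?mulr0.
rewrite cpowS cprod_deriv.
rewrite (@cprod_ext f f _ (fun i => k.+1%:R * cprod (fun j => j%:R * f j) (cpow f k) i))//.
rewrite (cprodC f) cprodZl (cprodC _ f) cprodA (cprodC f) -cprodA -cpowS.
by rewrite -[k.+2]addn1 natrD mulrDl mul1r addrC.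
Qed.

End Convolution.
Arguments delta {R}.
Arguments ones {R}.

(** * Sequences of size O((log n)^j / n) *)

Section Growth.
Variable R : realType.
Implicit Types (f g : nat -> R).

Definition harm (n : nat) : R := \sum_(i < n) i.+1%:R^-1.

Lemma harmS n : harm n.+1 = harm n + n.+1%:R^-1.
Proof. by rewrite /harm big_ord_recr. Qed.

Lemma harm_ge1 n : 1 <= harm n.+1.
Proof.
by rewrite /harm big_ord_recl /= invr1 lerDl sumr_ge0// => i _; rewrite invr_ge0.
Qed.

Lemma harm_ge0 n : 0 <= harm n.
Proof. by apply: sumr_ge0 => i _; rewrite invr_ge0. Qed.

Lemma le_harm m n : (m <= n)%N -> harm m <= harm n.
Proof.
move=> /subnKC <-; elim: (n - m)%N => [|d IH]; first by rewrite addn0.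
by rewrite addnS harmS (le_trans IH)// lerDl invr_ge0.
Qed.

(** The harmonic number stands in for the logarithm: [harm n.+1] is at least 1, so one bound covers
    every index from 0 on. *)
Definition growth (j : nat) f :=
  exists C : R, forall n, `|f n| <= C * (harm n.+1 ^+ j / n.+1%:R).

Lemma growth_rate_ge0 j n : 0 <= harm n.+1 ^+ j / n.+1%:R.
Proof. by rewrite divr_ge0// exprn_ge0// harm_ge0. Qed.

Lemma growth_const_ge0 j f C :
  (forall n, `|f n| <= C * (harm n.+1 ^+ j / n.+1%:R)) -> 0 <= C.
Proof.
move=> HC; have := le_trans (normr_ge0 _) (HC 0).
by rewrite /harm big_ord1 invr1 expr1n !mulr1.
Qed.

Lemma growthD j f g : growth j f -> growth j g -> growth j (fun n => f n + g n).
Proof.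
move=> [C HC] [D HD]; exists (C + D) => n.
by rewrite mulrDl (le_trans (ler_normD _ _))// lerD.
Qed.

Lemma growth_ext j f g : f =1 g -> growth j f -> growth j g.
Proof. by move=> fg [C HC]; exists C => n; rewrite -fg. Qed.

(** Partial fractions: 1/(ab) = (1/a + 1/b)/(a + b), where a + b = n + 2 is the same for all
    terms. *)
Lemma growth_conv_harm n :
  \sum_(i < n.+1) i.+1%:R^-1 * (n - i).+1%:R^-1 = 2 * harm n.+1 / n.+2%:R :> R.
Proof.
have -> : 2 * harm n.+1 / n.+2%:R =
    \sum_(i < n.+1) (i.+1%:R^-1 + (n - i).+1%:R^-1) / n.+2%:R :> R.
  rewrite -mulr_suml big_split /= mulrDl mul1r; congr ((_ + _) / _).
  rewrite /harm (reindex_inj rev_ord_inj) /=; apply: eq_bigr => i _.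
  by rewrite subSS.
apply: eq_bigr => i _; have le_in : (i <= n)%N by rewrite -ltnS.
have -> : n.+2%:R = i.+1%:R + (n - i).+1%:R :> R.
  by rewrite -natrD; congr _%:R; lia.
field.
have p1 : 0 < i.+1%:R :> R by rewrite ltr0n.
have p2 : 0 < (n - i).+1%:R :> R by rewrite ltr0n.
by rewrite !gt_eqF// addr_gt0.
Qed.

(** The powers of [harm] are monotone and leave the sum; the remaining convolution of 1/n with
    itself costs one further factor [harm]. *)
Lemma growth_cprod i j f g : growth i f -> growth j g -> growth (i + j).+1 (cprod f g).
Proof.
move=> [C HC] [D HD]; exists (2 * (C * D)) => n.
have C0 := growth_const_ge0 HC.
have D0 := growth_const_ge0 HD.
apply: (@le_trans _ _ (\sum_(u < n.+1) C * D * harm n.+1 ^+ (i + j) *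
    (u.+1%:R^-1 * (n - u).+1%:R^-1))).
  apply: le_trans (ler_norm_sum _ _ _) _; apply: ler_sum => u _.
  have un : (u <= n)%N by rewrite -ltnS.
  rewrite normrM; apply: (@le_trans _ _
    (C * (harm n.+1 ^+ i / u.+1%:R) * (D * (harm n.+1 ^+ j / (n - u).+1%:R)))).
    apply: ler_pM => //.
      apply: le_trans (HC u) _; rewrite ler_wpM2l// ler_wpM2r ?invr_ge0//.
      by rewrite lerXn2r ?nnegrE ?harm_ge0// le_harm.
    apply: le_trans (HD _) _; rewrite ler_wpM2l// ler_wpM2r ?invr_ge0//.
    by rewrite lerXn2r ?nnegrE ?harm_ge0// le_harm// ltnS leq_subr.
  by rewrite exprD le_eqVlt; apply/orP; left; apply/eqP; ring.
rewrite -mulr_sumr growth_conv_harm exprSr.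
have -> : C * D * harm n.+1 ^+ (i + j) * (2 * harm n.+1 / n.+2%:R) =
  2 * (C * D) * (harm n.+1 ^+ (i + j) * harm n.+1 / n.+2%:R) by ring.
rewrite ler_wpM2l ?mulr_ge0//; rewrite ler_wpM2l ?mulr_ge0 ?exprn_ge0 ?harm_ge0//.
by rewrite lef_pV2 ?posrE ?ltr0n// ler_nat.
Qed.

Lemma growth_cpow f k : growth 0 f -> growth k (cpow f k.+1).
Proof.
move=> gf; elim: k => [|k IH].
  by rewrite cpowS cprodC cprod_delta.
by rewrite cpowS -[k]add0n; apply: growth_cprod.
Qed.

(* w^(k+1) - v^(k+1) = w (w^k - v^k) + (w - v) v^k *)
Lemma growth_cpowB w v k : growth 0 w -> growth 0 v ->
  growth 0 (cprod ones (fun n => w n - v n)) ->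
  growth k (fun n => cprod ones (cpow w k.+1) n - cprod ones (cpow v k.+1) n).
Proof.
move=> gw gv gd; elim: k => [|k IH].
  apply: growth_ext gd => n.
  rewrite !cpowS !(cprodC _ delta) !cprod_delta.
  by rewrite cprodC cprodBl !(cprodC _ ones).
apply: (@growth_ext _ (fun n =>
   cprod w (fun n => cprod ones (cpow w k.+1) n - cprod ones (cpow v k.+1) n) n +
   cprod (cprod ones (fun n => w n - v n)) (cpow v k.+1) n)).
  move=> n; rewrite [cpow w k.+2]cpowS [cpow v k.+2]cpowS.
  move: (cpow w k.+1) (cpow v k.+1) => W V.
  have -> : cprod w (fun n => cprod ones W n - cprod ones V n) n =
      cprod ones (cprod w W) n - cprod ones (cprod w V) n.
    by rewrite cprodC cprodBl !(cprodC _ w) !cprodA (cprodC w).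
  have -> : cprod (cprod ones (fun n => w n - v n)) V n =
      cprod ones (cprod w V) n - cprod ones (cprod v V) n.
    rewrite -cprodA cprodC.
    rewrite (_ : cprod _ V = fun m => cprod w V m - cprod v V m); last first.
      by apply/funext => m; rewrite cprodBl.
    by rewrite cprodBl !(cprodC _ ones).
  ring.
apply: growthD.
  by rewrite -[k]add0n; apply: growth_cprod.
by rewrite -[k]add0n; apply: growth_cprod => //; apply: growth_cpow.
Qed.

(** The finitely many initial terms are absorbed into the constant, since the rate at index i is at
    least 1/(i+1). *)
Lemma growth_eventually j f n0 (C : R) :
  (forall n, (n0 <= n)%N -> `|f n| <= C * (harm n.+1 ^+ j / n.+1%:R)) -> growth j f.
Proof.
move=> HC; exists (`|C| + \sum_(i < n0) `|f i| * i.+1%:R) => n.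
have [nn|nn] := leqP n0 n.
  apply: le_trans (HC n nn) _; rewrite ler_wpM2r ?growth_rate_ge0//.
  by rewrite (le_trans (ler_norm _))// lerDl sumr_ge0.
rewrite mulrDl; apply: ler_wpDl; first by rewrite mulr_ge0// growth_rate_ge0.
rewrite mulr_suml (bigD1 (Ordinal nn))//=; apply: ler_wpDr.
  by apply: sumr_ge0 => i _; rewrite mulr_ge0 ?growth_rate_ge0// mulr_ge0.
rewrite -mulrA ler_peMr// mulrCA divff ?mulr1 ?pnatr_eq0//.
by rewrite exprn_ege1// harm_ge1.
Qed.

End Growth.

(** * Mertens' theorems *)

Lemma prime_dvd_fact p n : prime p -> (p %| n`!)%N = (p <= n)%N.
Proof.
move=> pp; apply/idP/idP => [|pn]; last by rewrite dvdn_fact// prime_gt0.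
elim: n => [|n IH]; first by rewrite fact0 dvdn1 => /eqP p1; move: pp; rewrite p1.
by rewrite factS Euclid_dvdM// => /orP[/dvdn_leq->//|/IH /leqW].
Qed.

(** Induction on [b]: a prime [b] is coprime to any product of smaller primes. *)
Lemma prod_prime_dvd a b N :
  (forall p, (a <= p < b)%N -> prime p -> (p %| N)%N) ->
  (\prod_(a <= p < b | prime p) p %| N)%N.
Proof.
have [ba|ab] := leqP b a; first by rewrite big_geq// dvd1n.
elim: b ab => // b IH; rewrite ltnS => ab H.
rewrite big_mkcond big_nat_recr//= -big_mkcond/=; have [eab|nab] := eqVneq a b.
  rewrite eab big_geq// mul1n; case: ifP => [pb|_]; last exact: dvd1n.
  by apply: H => //; rewrite ab leqnn.
have {}IH : (\prod_(a <= p < b | prime p) p %| N)%N.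
  by apply: IH => [|p /andP[ap pb] pp]; [lia|apply: H => //; lia].
case: ifP => [pb|_]; last by rewrite muln1.
rewrite Gauss_dvd ?IH ?H ?ab ?leqnn//.
rewrite coprime_sym prime_coprime// Euclid_dvd_prod//.
rewrite big_has_cond; apply/hasPn => p; rewrite mem_index_iota => /andP[_ pb'].
apply/negP => /andP[pp bp].
have := dvdn_leq (prime_gt0 pp) bp; lia.
Qed.

(** The expansion of (1 + 1)^(2m+1) contains the two equal middle coefficients. *)
Lemma bin_odd_mid_le m : ('C(m.*2.+1, m) <= 4 ^ m)%N.
Proof.
suff : (2 * 'C(m.*2.+1, m) <= 2 * 4 ^ m)%N by rewrite leq_pmul2l.
have -> : (2 * 4 ^ m = (1 + 1) ^ m.*2.+1)%N.
  by rewrite expnS -[m.*2]mul2n expnM.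
rewrite expnDn; have mm : (m < m.*2.+2)%N by lia.
have m1m : (m.+1 < m.*2.+2)%N by lia.
rewrite (bigD1 (Ordinal mm))//= (bigD1 (Ordinal m1m))/=; last first.
  by apply/negP => /eqP/(congr1 val)/=; lia.
rewrite !exp1n !muln1 mul2n -addnn.
have -> : 'C(m.*2.+1, m.+1) = 'C(m.*2.+1, m).
  by rewrite -[RHS]bin_sub; [congr 'C(_, _); lia|lia].
by rewrite addnA leq_addr.
Qed.

(** Erdos's argument. An even n > 2 contributes no prime; for n = 2m+1 the primes from m+2 to n all
    divide C(2m+1, m) <= 4^m, and induction handles those up to m+1. *)
Lemma primorial_le n : (\prod_(0 <= p < n.+1 | prime p) p <= 4 ^ n)%N.
Proof.
elim/ltn_ind: n => n IH.
have [n2|n2] := leqP n 2.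
  move: n n2 {IH} => [|[|[|//]]] _; by rewrite unlock.
have [on|en] := boolP (odd n); last first.
  have np : prime n = false.
    by apply/negP => /even_prime[|o]; [lia|rewrite o in en].
  rewrite big_mkcond big_nat_recr//= np muln1 -big_mkcond.
  have -> : n = n.-1.+1 by lia.
  by rewrite (leq_trans (IH n.-1 _)) ?leq_exp2l//; lia.
have [m nm m1] : exists2 m, n = m.*2.+1 & (0 < m)%N.
  by exists n./2; lia.
rewrite (@big_cat_nat _ _ _ m.+2)//=; last by lia.
have -> : (4 ^ n = 4 ^ m.+1 * 4 ^ m)%N by rewrite -expnD; congr (_ ^ _)%N; lia.
apply: leq_mul; first by apply: IH; lia.
rewrite nm; apply: leq_trans (bin_odd_mid_le m).
apply: dvdn_leq; first by rewrite bin_gt0; lia.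
apply: prod_prime_dvd => p /andP[mp pm] pp.
have : (p %| m.*2.+1`!)%N by rewrite prime_dvd_fact//; lia.
rewrite -(@bin_fact m.*2.+1 m); last by lia.
rewrite Euclid_dvdM// Euclid_dvdM// !prime_dvd_fact// => /orP[//|].
lia.
Qed.

(** * Chebyshev's theta function and logarithms of factorials *)

Section LogSums.
Variable R : realType.

Lemma ln_prod (r : seq nat) (P : pred nat) (F : nat -> nat) :
  (forall i, P i -> (0 < F i)%N) ->
  ln ((\prod_(i <- r | P i) F i)%N%:R : R) = \sum_(i <- r | P i) ln (F i)%:R.
Proof.
move=> F0; elim: r => [|i r IH]; first by rewrite !big_nil ln1.
rewrite !big_cons; case: ifP => // Pi.
by rewrite natrM lnM ?IH// posrE ltr0n ?F0// prodn_cond_gt0.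
Qed.

Lemma ln_nat_ge0 n : 0 <= ln (n%:R : R).
Proof.
by case: n => [|n]; [rewrite ln0|rewrite ln_ge0// ler1n].
Qed.

Definition theta (n : nat) : R := \sum_(0 <= p < n.+1 | prime p) ln p%:R.

Lemma theta_le n : theta n <= n%:R * ln 4.
Proof.
rewrite /theta -(@ln_prod _ prime id); last by move=> p /prime_gt0.
rewrite mulr_natl -lnXn// ler_ln ?posrE; last 2 first.
- by rewrite ltr0n prodn_cond_gt0// => p /prime_gt0.
- by rewrite exprn_gt0.
by rewrite -natrX ler_nat primorial_le.
Qed.

Lemma ln_factE n :
  ln (n`!%:R : R) = \sum_(0 <= p < n.+1 | prime p) (logn p n`!)%:R * ln p%:R.
Proof.
rewrite -[in LHS](@partnT n`!) ?fact_gt0// /partn.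
(* The factorization of n! ranges over all indices up to n!; those above n carry exponent 0. *)
rewrite (@big_cat_nat _ _ _ n.+1)//=; last by rewrite ltnS fact_geq.
rewrite [X in (_ * X)%N]big1_seq ?muln1; last first.
  move=> p /andP[_]; rewrite mem_index_iota => /andP[np _].
  have [pp|pp] := boolP (prime p); last by rewrite lognE (negbTE pp) expn0.
  by rewrite lognE pp fact_gt0 prime_dvd_fact// leqNgt np expn0.
have -> : (\prod_(0 <= p < n.+1 | p \in predT) p ^ logn p n`! =
    \prod_(0 <= p < n.+1 | prime p) p ^ logn p n`!)%N.
  rewrite [RHS]big_mkcond; apply: eq_bigr => p _; case: ifP => // pp.
  by rewrite lognE pp expn0.
rewrite ln_prod => [|p pp]; last by rewrite expn_gt0 prime_gt0.
apply: eq_bigr => p pp.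
by rewrite natrX lnXn ?ltr0n ?prime_gt0// mulr_natl.
Qed.

Lemma ln_succ_sub_le n : ln n.+2%:R - ln n.+1%:R <= n.+1%:R^-1 :> R.
Proof.
rewrite -ln_div ?posrE ?ltr0n//.
have -> : n.+2%:R / n.+1%:R = 1 + n.+1%:R^-1 :> R.
  by rewrite -[n.+2%:R]natr1 addrC mulrDl mul1r addrC divff ?pnatr_eq0.
rewrite le_ln1Dx//.
by rewrite (lt_le_trans (ltrN10 _))// invr_ge0.
Qed.

Lemma ln_succ_sub_ge n : n.+2%:R^-1 <= ln n.+2%:R - ln n.+1%:R :> R.
Proof.
rewrite -[leRHS]opprK opprB -ln_div ?posrE ?ltr0n//.
have -> : n.+1%:R / n.+2%:R = 1 + - n.+2%:R^-1 :> R.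
  by rewrite -[n.+1%:R](addrK 1) natr1 mulrBl divff ?pnatr_eq0// mul1r.
rewrite lerNr le_ln1Dx// ltrN2.
by rewrite invf_lt1 ?ltr0n// ltr1n.
Qed.

Lemma ln_fact_le n : ln (n`!%:R : R) <= n%:R * ln n%:R.
Proof.
case: n => [|n]; first by rewrite fact0 ln1 mul0r.
rewrite mulr_natl -lnXn ?ltr0n// ler_ln ?posrE ?ltr0n ?fact_gt0//.
rewrite -natrX ler_nat; elim: n => // n IH.
by rewrite factS expnS leq_mul// (leq_trans IH)// leq_exp2r.
Qed.

(** A weak Stirling bound: the induction step reduces to (n+1)(ln(n+2) - ln(n+1)) <= 1. *)
Lemma ln_fact_ge n : n%:R * ln n%:R - n%:R <= ln (n`!%:R : R).
Proof.
case: n => [|n]; first by rewrite fact0 ln1 !mul0r subr0.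
elim: n => [|n IH]; first by rewrite ?fact1 ?ln1; lra.
rewrite factS natrM lnM ?posrE ?ltr0n ?fact_gt0//.
have H : n.+1%:R * (ln n.+2%:R - ln n.+1%:R) <= 1 :> R.
  by rewrite mulrC -ler_pdivlMr ?ltr0n// div1r ln_succ_sub_le.
have E : n.+2%:R = n.+1%:R + 1 :> R by rewrite natr1.
move: H; move: (ln n.+2%:R) => L H; rewrite E; lra.
Qed.

End LogSums.

(** * Limits with explicit rates; Mertens' theorems along the integers *)

Section LimitRate.
Variable R : realType.

(** The intervals [u n - g n, u n + g n] are nested, so the supremum of their left ends lies in all
    of them. *)
Lemma telescope_limit (u g : nat -> R) : (forall n, 0 <= g n) ->
  (forall n, `|u n.+1 - u n| <= g n - g n.+1) ->
  exists l, forall n, `|u n - l| <= g n.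
Proof.
move=> g0 ug.
have step n : u n - g n <= u n.+1 - g n.+1 /\ u n.+1 + g n.+1 <= u n + g n.
  by have := ug n; rewrite ler_norml => /andP[]; split; lra.
have lo n d : u n - g n <= u (n + d)%N - g (n + d)%N.
  by elim: d => [|d IH]; rewrite ?addn0// addnS; apply: le_trans IH (step _).1.
have hi n d : u (n + d)%N + g (n + d)%N <= u n + g n.
  by elim: d => [|d IH]; rewrite ?addn0// addnS; apply: le_trans (step _).2 IH.
have lohi m n : u m - g m <= u n + g n.
  apply: le_trans (lo m n) _; apply: le_trans (hi n m).
  by rewrite [(n + m)%N]addnC; have := g0 (m + n)%N; lra.
pose E := range (fun n => u n - g n).
have Eub n : ubound E (u n + g n) by move=> _ [m _ <-].
exists (sup E) => n.
have E0 : E !=set0 by exists (u 0 - g 0); exists 0%N.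
have h1 : u n - g n <= sup E by apply: ub_le_sup; [exists (u 0 + g 0)|exists n].
have h2 : sup E <= u n + g n by apply: ge_sup.
by rewrite ler_norml; apply/andP; split; lra.
Qed.

Lemma ln_sub_le (a b : R) : 0 < a -> 0 < b -> ln b - ln a <= (b - a) / a.
Proof.
move=> a0 b0; rewrite -ln_div ?posrE//.
have -> : (b - a) / a = b / a - 1 by rewrite mulrBl divff ?gt_eqF.
have := @le_ln1Dx R (b / a - 1); rewrite addrCA subrr addr0; apply.
by rewrite -subr_gt0 opprK subrK divr_gt0.
Qed.

Lemma ln_sub_ge (a b : R) : 0 < a -> 0 < b -> (b - a) / b <= ln b - ln a.
Proof.
move=> a0 b0; rewrite -[leRHS]opprB lerNr -mulNr opprB; exact: ln_sub_le.
Qed.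

(** The limit is Euler's constant; each increment lies between 0 and 1/(n+1) - 1/(n+2). *)
Lemma harm_ln_limit : exists g : R, forall n,
  `|harm R n - ln n.+1%:R - g| <= n.+1%:R^-1.
Proof.
apply: telescope_limit => [n|n]; first by rewrite invr_ge0.
rewrite harmS; have := ln_succ_sub_le R n; have := ln_succ_sub_ge R n.
move: (ln n.+2%:R) (ln n.+1%:R) n.+1%:R^-1 n.+2%:R^-1 (harm R n) => a b c d e h1 h2.
by rewrite ler_norml; apply/andP; split; lra.
Qed.

(** Only the first term of Legendre's formula is kept. *)
Lemma logn_fact_ge p n : prime p -> n%:R / p%:R - 1 <= (logn p n`!)%:R :> R.
Proof.
move=> pp; case: n => [|n]; first by rewrite mul0r; have := ler0n R (logn p 0`!); lra.
apply: (@le_trans _ _ (n.+1 %/ p)%:R).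
  rewrite lerBlDr natr1 ler_pdivrMr ?ltr0n ?prime_gt0// -natrM ler_nat ltnW//.
  exact: ltn_ceil (prime_gt0 pp).
by rewrite ler_nat logn_fact// big_ltn// expn1 leq_addr.
Qed.

(** Legendre's formula without the floors is bounded by a geometric series. *)
Lemma logn_fact_le p n : prime p -> (logn p n`!)%:R <= n%:R / (p%:R - 1) :> R.
Proof.
move=> pp; have p1 : 0 < p%:R - 1 :> R by rewrite subr_gt0 ltr1n prime_gt1.
have p0 : 0 < p%:R :> R by rewrite ltr0n prime_gt0.
have geo m : \sum_(1 <= k < m.+1) (p%:R ^- k) = (1 - p%:R ^- m) / (p%:R - 1) :> R.
  elim: m => [|m IH]; first by rewrite big_geq// expr0 invr1 subrr mul0r.
  rewrite big_nat_recr//= IH exprS; field.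
  by rewrite !gt_eqF// exprn_gt0.
rewrite logn_fact// natr_sum; apply: (@le_trans _ _ (\sum_(1 <= k < n.+1) n%:R * p%:R ^- k)).
  apply: ler_sum => k _; rewrite ler_pdivlMr ?exprn_gt0// -natrX -natrM ler_nat.
  exact: leq_trunc_div.
by rewrite -mulr_sumr geo ler_wpM2l// ler_piMl ?invr_ge0 ?(ltW p1).
Qed.

(** This controls the higher prime powers in n!: 1/(p-1) exceeds 1/p by 1/(p(p-1)). *)
Lemma sum_ln_prime_div_le n :
  \sum_(0 <= p < n.+1 | prime p) ln p%:R / (p%:R * (p%:R - 1)) <= 2 :> R.
Proof.
case: n => [|n]; first by rewrite unlock /=.
(* The increments of (ln n + 2) / n dominate the terms. *)
suff H : \sum_(0 <= p < n.+2 | prime p) ln p%:R / (p%:R * (p%:R - 1)) <=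
    2 - (ln n.+1%:R + 2) / n.+1%:R :> R.
  apply: le_trans H _; rewrite gerBl divr_ge0// addr_ge0//; exact: ln_nat_ge0.
elim: n => [|n IH].
  by rewrite big_mkcond /= unlock /= ln1 !addr0 add0r divr1 subrr.
rewrite big_mkcond big_nat_recr//= -big_mkcond /=.
have t0 : 0 <= ln n.+2%:R / (n.+2%:R * (n.+2%:R - 1)) :> R.
  by rewrite divr_ge0 ?ln_nat_ge0// mulr_ge0// subr_ge0 ler1n.
have t1 : ln n.+2%:R / (n.+2%:R * (n.+2%:R - 1)) <=
    (ln n.+1%:R + 2) / n.+1%:R - (ln n.+2%:R + 2) / n.+2%:R :> R.
  have x0 : 0 < n.+1%:R :> R by rewrite ltr0n.
  have x1 : 1 <= n.+1%:R :> R by rewrite ler1n.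
  have H : n.+1%:R * (ln n.+2%:R - ln n.+1%:R) <= 1 :> R.
    by rewrite mulrC -ler_pdivlMr// div1r ln_succ_sub_le.
  have H1 : ln n.+2%:R - ln n.+1%:R <= 1 :> R.
    by rewrite (le_trans (ln_succ_sub_le _ _))// invf_le1.
  have E : n.+2%:R = n.+1%:R + 1 :> R by rewrite natr1.
  move: (ln n.+2%:R) (ln n.+1%:R) H H1 => a b; rewrite E.
  move: n.+1%:R x0 x1 => x x0 x1 H H1; rewrite addrK -subr_ge0.
  have -> : (b + 2) / x - (a + 2) / (x + 1) - a / ((x + 1) * x) =
     (b + 2 - x * (a - b) - a) / (x * (x + 1)) by field; rewrite !gt_eqF//; lra.
  by apply: divr_ge0; [lra|rewrite mulr_ge0//; lra].
move: t0 t1 IH; move: (ln n.+2%:R / _) (_ / n.+1%:R) (_ / n.+2%:R) => t u v t0 t1 IH.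
by case: ifP => _; lra.
Qed.

Definition ln_prime_sum (n : nat) : R := \sum_(0 <= p < n.+1 | prime p) ln p%:R / p%:R.

(** Mertens' first theorem. The prime factorization of n! puts ln n! within O(n) of n times the sum,
    using Chebyshev's bound on [theta] on one side; Stirling's bounds put it within n of n ln n. *)
Lemma ln_prime_sum_bound n : `|ln_prime_sum n.+1 - ln n.+1%:R| <= 4.
Proof.
have x0 : 0 < n.+1%:R :> R by rewrite ltr0n.
have lo : n.+1%:R * ln_prime_sum n.+1 - theta R n.+1 <= ln (n.+1`!%:R : R).
  rewrite ln_factE /ln_prime_sum /theta mulr_sumr -sumrB; apply: ler_sum => p pp.
  have -> : n.+1%:R * (ln p%:R / p%:R) - ln p%:R = (n.+1%:R / p%:R - 1) * ln p%:R :> R.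
    by ring.
  by rewrite ler_wpM2r ?ln_nat_ge0// logn_fact_ge.
have hi : ln (n.+1`!%:R : R) <= n.+1%:R * ln_prime_sum n.+1 + n.+1%:R * 2.
  rewrite ln_factE; apply: le_trans (_ : _ <= n.+1%:R * ln_prime_sum n.+1 +
    n.+1%:R * \sum_(0 <= p < n.+2 | prime p) ln p%:R / (p%:R * (p%:R - 1))) _.
    rewrite -mulrDr -big_split /= mulr_sumr; apply: ler_sum => p pp.
    have p1 : 0 < p%:R - 1 :> R by rewrite subr_gt0 ltr1n prime_gt1.
    have p0 : 0 < p%:R :> R by rewrite ltr0n prime_gt0.
    have -> : n.+1%:R * (ln p%:R / p%:R + ln p%:R / (p%:R * (p%:R - 1))) =
       n.+1%:R / (p%:R - 1) * ln p%:R :> R by field; rewrite !gt_eqF.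
    by rewrite ler_wpM2r ?ln_nat_ge0// logn_fact_le.
  by rewrite lerD2l ler_wpM2l// ?sum_ln_prime_div_le// ltW.
have := theta_le R n.+1; have := ln_fact_le R n.+1; have := ln_fact_ge R n.+1.
have l4 : ln (4 : R) <= 4 by rewrite ltW// ln_sublinear.
move=> f1 f2 th.
have : n.+1%:R * (ln_prime_sum n.+1 - ln n.+1%:R) <= n.+1%:R * ln 4 by lra.
have : n.+1%:R * (ln n.+1%:R - ln_prime_sum n.+1) <= n.+1%:R * 3 by lra.
rewrite !ler_pM2l// => h1 h2.
by rewrite ler_norml; apply/andP; split; lra.
Qed.

Definition prime_inv_sum (n : nat) : R := \sum_(0 <= p < n.+1 | prime p) p%:R^-1.

Lemma prime_inv_sum_limit : exists B : R, forall n, 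
  `|prime_inv_sum n.+2 - ln (ln n.+2%:R) - B| <= 9 / ln n.+2%:R.
Proof.
(* Abel summation: subtracting r n / ln n makes the increments telescope. *)
pose r n := ln_prime_sum n - ln n%:R.
pose V n := prime_inv_sum n.+2 - ln (ln n.+2%:R) - r n.+2 / ln n.+2%:R.
have l0 n : 0 < ln (n.+2%:R : R) by rewrite ln_gt0// ltr1n.
(* Of the 5, a share of 4 comes from the bound on [r], and 1 from comparing (b - a)/b with ln b - ln
   a. *)
have [B HB] : exists B, forall n, `|V n - B| <= 5 / ln n.+2%:R.
  apply: telescope_limit => n; first by rewrite divr_ge0// ltW.
  set a := ln (n.+2%:R : R); set b := ln (n.+3%:R : R).
  have a0 : 0 < a by exact: l0.
  have b0 : 0 < b by exact: l0.
  have ab : a <= b by rewrite ler_ln ?posrE ?ltr0n// ler_nat.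
  have ab1 : b - a <= 1.
    by rewrite (le_trans (ln_succ_sub_le _ _))// invf_le1 ?ltr0n// ler1n.
  have PL : prime_inv_sum n.+3 - prime_inv_sum n.+2 = (ln_prime_sum n.+3 - ln_prime_sum n.+2) / b.
    rewrite /prime_inv_sum /ln_prime_sum big_mkcond big_nat_recr//= -big_mkcond /=.
    rewrite [X in (X - _) / b]big_mkcond [X in (X - _) / b]big_nat_recr//= -big_mkcond /=.
    rewrite !(addrC _ (if _ then _ else _)) !addrK.
    case: ifP => _; last by rewrite mul0r.
    by rewrite -/b mulrAC divff ?mul1r ?gt_eqF.
  have VE : V n.+1 - V n = ((b - a) / b - (ln b - ln a)) + r n.+2 * (a^-1 - b^-1).
    have -> : V n.+1 - V n = (prime_inv_sum n.+3 - prime_inv_sum n.+2) - (ln b - ln a)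
        - r n.+3 / b + r n.+2 / a by rewrite /V -/a -/b; ring.
    rewrite PL.
    have -> : ln_prime_sum n.+3 = r n.+3 + b by rewrite /r /b subrK.
    have -> : ln_prime_sum n.+2 = r n.+2 + a by rewrite /r /a subrK.
    by field; rewrite !gt_eqF.
  rewrite VE; have i0 : 0 <= a^-1 - b^-1 by rewrite subr_ge0 lef_pV2.
  have h1 : (b - a) / b <= ln b - ln a by apply: ln_sub_ge.
  have h2 : ln b - ln a <= (b - a) / a by apply: ln_sub_le.
  have h3 : (b - a) * (a^-1 - b^-1) <= 1 * (a^-1 - b^-1) by rewrite ler_wpM2r.
  have h4 : `|r n.+2 * (a^-1 - b^-1)| <= 4 * (a^-1 - b^-1).
    by rewrite normrM (ger0_norm i0) ler_wpM2r// ln_prime_sum_bound.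
  have h5 : `|(b - a) / b - (ln b - ln a)| <= a^-1 - b^-1.
    rewrite ler_norml; apply/andP; split; lra.
  apply: le_trans (ler_normD _ _) _; lra.
exists B => n.
(* Restoring the subtracted term costs another 4, whence the total 9. *)
have h4 : `|r n.+2 / ln n.+2%:R| <= 4 / ln n.+2%:R.
  rewrite normrM [`|_^-1|]ger0_norm ?invr_ge0 ?(ltW (l0 _))//.
  by rewrite ler_wpM2r ?invr_ge0 ?(ltW (l0 _))// ln_prime_sum_bound.
have -> : prime_inv_sum n.+2 - ln (ln n.+2%:R) - B = (V n - B) + r n.+2 / ln n.+2%:R.
  by rewrite /V; ring.
apply: le_trans (ler_normD _ _) _; have := HB n; lra.
Qed.

End LimitRate.

(** * Mertens' second theorem for real arguments *)

Section Mertens.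
Variable R : realType.

Lemma prime_inv_sumE (x : R) : 0 <= x ->
  \sum_(p \in primes_le x) (p%:R : R)^-1 = prime_inv_sum R (Num.truncn x).
Proof.
move=> x0; rewrite /prime_inv_sum.
have trE p : (p < (Num.truncn x).+1)%N = (p%:R <= x) by rewrite ltnS truncn_ge_nat.
transitivity (\sum_(0 <= p < (Num.truncn x).+1 | prime p && (p%:R <= x)) (p%:R : R)^-1).
  have -> : primes_le x = [set` [pred p | prime p && (p%:R <= x)]].
    by apply/seteqP; split=> p /=; [move=> [pp px]; rewrite inE pp|rewrite inE => /andP[]].
  rewrite [RHS]bigfs ?iota_uniq//.
  by move=> p /andP[_ px]; rewrite mem_index_iota/= trE px.
rewrite big_nat_cond [RHS]big_nat_cond; apply: eq_bigl => p /=.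
by rewrite trE; case: (p%:R <= x) => /=; rewrite ?andbT ?andbF.
Qed.

Lemma mertens_second : exists B K : R, forall x, 2 <= x ->
  `|prime_inv_sum R (Num.truncn x) - log2 x - B| <= K / ln x.
Proof.
(* Passing from floor(x) to x moves the iterated logarithm by at most 1/ln floor(x), and 1/ln
   floor(x) <= 2/ln x, so 20 = 2 (9 + 1). *)
have [B HB] := prime_inv_sum_limit R; exists B, 20 => x x2.
have x0 : 0 < x by lra.
have [n xn] : exists n, Num.truncn x = n.+2.
  have : (2 <= Num.truncn x)%N by rewrite truncn_ge_nat// ltW.
  by case: (Num.truncn x) => [|[|n]]// _; exists n.
have /andP[nx xn1] := truncn_itv (ltW x0).
rewrite xn in nx xn1 *; have := HB n.
have n0 : 0 < n.+2%:R :> R by rewrite ltr0n.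
have l0 : 0 < ln (n.+2%:R : R) by rewrite ln_gt0// ltr1n.
have lx : ln n.+2%:R <= ln x by rewrite ler_ln ?posrE.
have lx0 : 0 < ln x by apply: lt_le_trans l0 lx.
have lx1 : ln x - ln n.+2%:R <= 1.
  apply: le_trans (ln_sub_le _ _) _ => //; rewrite ler_pdivrMr// mul1r.
  have : 2 <= n.+2%:R :> R by rewrite ler_nat.
  by move: xn1; rewrite -[n.+3%:R]natr1; lra.
have lx2 : ln x <= 2 * ln n.+2%:R.
  rewrite mulr_natl -lnXn// ler_ln ?posrE ?exprn_gt0//.
  rewrite (le_trans (ltW xn1))// -natrX ler_nat; lia.
have h1 : ln (ln x) - ln (ln n.+2%:R) <= (ln n.+2%:R)^-1.
  apply: le_trans (ln_sub_le _ _) _ => //.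
  by rewrite -[leRHS]mul1r ler_wpM2r// invr_ge0 ltW.
have h2 : 0 <= ln (ln x) - ln (ln n.+2%:R) by rewrite subr_ge0 ler_ln ?posrE.
have h3 : (ln n.+2%:R)^-1 <= 2 * (ln x)^-1 :> R.
  by rewrite -ler_pdivrMl// -invfM lef_pV2 ?posrE ?mulr_gt0//.
rewrite /log2 !ler_norml; move: (ln n.+2%:R)^-1 (ln x)^-1 h1 h3 => i j h1 h3.
move=> /andP[k1 k2]; apply/andP; split; lra.
Qed.

(** The rate forces convergence, which identifies the constant found above with the limit defining
    [mertens_B]. *)
Lemma mertens_B_rate : exists K : R, forall x, 2 <= x ->
  `|prime_inv_sum R (Num.truncn x) - log2 x - mertens_B R| <= K / ln x.
Proof.
have [B [K HK]] := mertens_second; exists K.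
suff -> : mertens_B R = B by [].
apply/cvg_lim => //; apply/cvgrPdistC_le => e e0.
near=> x; have x2 : 2 <= x by near: x; apply: nbhs_pinfty_ge; rewrite num_real.
rewrite prime_inv_sumE; last by lra.
apply: le_trans (HK _ x2) _.
have x0 : 0 < x by lra.
have lx0 : 0 < ln x by rewrite ln_gt0//; lra.
rewrite ler_pdivrMr// mulrC -ler_pdivrMr//.
by rewrite -[leLHS]expRK ler_ln ?posrE ?expR_gt0.
Unshelve. all: by end_near. Qed.

(** * Bucket weights and their model *)

(** Exceeds every integer up to e^(N+1), hence every prime in a bucket of index at most [N]. *)
Definition wbound (N : nat) : nat := (Num.truncn (expR (N.+1%:R : R))).+1.

(* For v within 1 of the logarithm, the bound on p removes nothing. *)
Definition weight (v : nat -> nat) (u : nat) : R :=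
  \sum_(0 <= p < wbound u | prime p && (v p == u)) p%:R^-1.

(** Loose enough to admit both floor(ln p) and floor(ln p) + 1, the roundings behind the two sides
    of the sandwich. *)
Definition near_ln (v : nat -> nat) := forall p, prime p ->
  (v p)%:R <= ln p%:R + 1 :> R /\ ln p%:R <= (v p).+1%:R :> R.

Lemma near_ln_bound v N p : near_ln v -> prime p -> (v p <= N)%N -> (p < wbound N)%N.
Proof.
move=> nv pp vN; rewrite ltnS truncn_ge_nat ?expR_ge0//.
have p0 : 0 < p%:R :> R by rewrite ltr0n prime_gt0.
rewrite -[leLHS]lnK ?posrE// ler_expR (le_trans (nv p pp).2)//.
by rewrite ler_nat ltnS.
Qed.

Lemma leq_wbound m n : (m <= n)%N -> (wbound m <= wbound n)%N.
Proof. by move=> mn; rewrite ltnS le_truncn// ler_expR ler_nat ltnS. Qed.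

Lemma weightE v u X : near_ln v -> (wbound u <= X)%N ->
  weight v u = \sum_(0 <= p < X | prime p && (v p == u)) p%:R^-1.
Proof.
move=> nv uX; rewrite [RHS](@big_cat_nat _ _ _ (wbound u))//=.
rewrite [X in _ + X]big1_seq ?addr0// => p /andP[/andP[pp /eqP vu]].
rewrite mem_index_iota => /andP[up _].
by have := @near_ln_bound v u p nv pp; rewrite vu leqnn ltnNge up => /(_ isT).
Qed.

(** Primes are grouped by bucket. Constant [F] gives the partial sums of [weight]; a general [F]
    lets one prime be split off a tuple. *)
Lemma weight_partition v N X (F : nat -> R) : near_ln v -> (wbound N <= X)%N ->
  \sum_(0 <= p < X | prime p && (v p <= N)%N) p%:R^-1 * F (v p) =
  \sum_(u < N.+1) weight v u * F u.
Proof.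
move=> nv NX.
rewrite (partition_big (fun p => inord (v p) : 'I_N.+1) predT)//=.
apply: eq_bigr => u _; have uN : (u <= N)%N by rewrite -ltnS.
rewrite (@weightE v u X)//; last by apply: leq_trans NX; apply: leq_wbound.
rewrite mulr_suml; apply: eq_big => [p|p /andP[/andP[pp vN] /eqP<-]]; last first.
  by rewrite inordK.
rewrite -andbA; congr andb; have [vN|vN] := leqP (v p) N; last first.
  by apply/esym/negbTE/negP => /eqP vu; move: vN; rewrite vu ltnNge uN.
by rewrite -val_eqE /= inordK.
Qed.

(** The free value at 0 shifts all partial sums by [c], so that they can match the constant in
    Mertens' theorem. *)
Definition model (c : R) (u : nat) : R := if u is 0 then c else u%:R^-1.

Lemma sum_model c n : \sum_(u < n.+1) model c u = c + harm R n.
Proof. by rewrite big_ord_recl. Qed.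

Lemma growth_model c : growth 0 (model c).
Proof.
exists (`|c| + 2) => -[|n]; rewrite expr0 div1r /=.
  by rewrite invr1 mulr1; lra.
have n0 : 0 < n.+1%:R :> R by rewrite ltr0n.
rewrite ger0_norm ?invr_ge0// ler_pdivlMr ?ltr0n//.
rewrite ler_pdivrMl// -[n.+2%:R]natr1.
have : 1 <= n.+1%:R :> R by rewrite ler1n.
have := normr_ge0 c; nra.
Qed.

(** Take c = B - gamma, gamma being Euler's constant. Up to index N the buckets contain all primes
    up to e^(N-1) and none above e^(N+1); at both ends Mertens' theorem gives ln N + B + O(1/N). *)
Lemma weight_model_rate : exists c : R,
  growth 0 (fun n => c + harm R n - ln n.+1%:R - mertens_B R) /\
  forall v, near_ln v ->
  growth 0 (weight v) /\ growth 0 (cprod ones (fun n => weight v n - model c n)).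
Proof.
have [g Hg] := harm_ln_limit R; have [K HK] := mertens_B_rate.
exists (mertens_B R - g); split.
  exists 1 => n; rewrite expr0 mul1r div1r.
  by rewrite (_ : _ - _ = harm R n - ln n.+1%:R - g) //; ring.
move=> v nv; set c := mertens_B R - g.
have dE n : cprod ones (fun n => weight v n - model c n) n =
    \sum_(u < n.+1) weight v u - (c + harm R n).
  by rewrite cprod_ones sumrB sum_model.
have K0 : 0 <= K.
  have := le_trans (normr_ge0 _) (HK 2 (lexx _)).
  by rewrite pmulr_lge0// invr_gt0 ln_gt0// ltr1n.
have expR2 (m : nat) : 2 <= expR (m.+1%:R : R).
  apply: le_trans (expR_ge1Dx _); have : 1 <= m.+1%:R :> R by rewrite ler1n.
  lra.
have gd : growth 0 (cprod ones (fun n => weight v n - model c n)).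
  (* With N = n+2, the lower end loses (K + 2)/(N-1) <= 3(K + 2)/(N+1), and Euler's constant another
     1/(N+1). Starting at N = 2 makes e^(N-1) >= 2. *)
  apply: (@growth_eventually _ _ _ 2 (3 * K + 7)) => -[|[|n]]// _.
  rewrite dE expr0 div1r.
  have wE : \sum_(u < n.+3) weight v u =
      \sum_(0 <= p < wbound n.+2 | prime p && (v p <= n.+2)%N) p%:R^-1.
    transitivity (\sum_(u < n.+3) weight v u * 1).
      by apply: eq_bigr => u _; rewrite mulr1.
    rewrite -(@weight_partition v n.+2 (wbound n.+2) (fun=> 1) nv (leqnn _)).
    by apply: eq_bigr => p _; rewrite mulr1.
  have hi : \sum_(u < n.+3) weight v u <= prime_inv_sum R (Num.truncn (expR (n.+3%:R : R))).
    rewrite wE /prime_inv_sum -/(wbound n.+2) [leLHS]big_mkcond [leRHS]big_mkcond.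
    apply: ler_sum => p _; have [pp/=|//] := boolP (prime p).
    by case: ifP => // _; rewrite invr_ge0.
  have lo : prime_inv_sum R (Num.truncn (expR (n.+1%:R : R))) <= \sum_(u < n.+3) weight v u.
    rewrite wE /prime_inv_sum -/(wbound n) (@big_nat_widen _ _ _ 0 (wbound n) (wbound n.+2)); last first.
      by apply: leq_wbound; lia.
    rewrite [leLHS]big_mkcond [leRHS]big_mkcond.
    apply: ler_sum => p _; have [pp/=|//] := boolP (prime p).
    case: ifP => pn; last by case: ifP => // _; rewrite invr_ge0.
    rewrite ifT// -(ler_nat R) (le_trans (nv p pp).1)//.
    rewrite -[n.+2%:R]natr1 lerD2r.
    move: pn; rewrite ltnS truncn_ge_nat ?expR_ge0// => pn.
    by rewrite -[leRHS]expRK ler_ln ?posrE ?ltr0n ?prime_gt0 ?expR_gt0.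
  have := HK _ (expR2 n.+2); have := HK _ (expR2 n); rewrite /log2 !expRK.
  have a0 : 0 < n.+1%:R :> R by rewrite ltr0n.
  have b0 : 0 < n.+3%:R :> R by rewrite ltr0n.
  have ab : n.+3%:R = n.+1%:R + 2 :> R by rewrite -natrD addn2.
  have a1 : 1 <= n.+1%:R :> R by rewrite ler1n.
  have i3 : n.+1%:R^-1 <= 3 * n.+3%:R^-1 :> R.
    by rewrite ler_pdivlMr// ler_pdivrMl//; lra.
  have l1 : ln n.+3%:R - ln n.+1%:R <= 2 * n.+1%:R^-1 :> R.
    by apply: le_trans (ln_sub_le _ _) _ => //; rewrite ab addrAC subrr add0r.
  have l2 : ln n.+1%:R <= ln n.+3%:R :> R by rewrite ler_ln ?posrE// ler_nat; lia.
  have Ki : K * n.+1%:R^-1 <= K * (3 * n.+3%:R^-1) by rewrite ler_wpM2l.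
  have Ki0 : 0 <= K * n.+3%:R^-1 by rewrite mulr_ge0// invr_ge0.
  have j0 : 0 <= n.+3%:R^-1 :> R by rewrite invr_ge0.
  have := Hg n.+2; move: hi lo; rewrite /c.
  move: (prime_inv_sum _ _) (prime_inv_sum _ _) (\sum_(_ < _) _) (harm _ _) => P Q W H.
  rewrite !ler_norml; move: i3 l1 l2 Ki Ki0 j0.
  move: (ln n.+1%:R) (ln n.+3%:R) n.+1%:R^-1 n.+3%:R^-1 => l3 l4 i j i3 l1 l2 Ki Ki0 j0.
  move=> hi lo /andP[g1 g2] /andP[p1 p2] /andP[q1 q2].
  apply/andP; split; lra.
split=> //; have [C HC] := gd; have [D HD] := growth_model c.
have C0 := growth_const_ge0 HC.
exists (D + C + 2 * C) => n; rewrite expr0 div1r.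
(* A single weight is recovered from consecutive differences of partial sums; the shifted one costs
   the factor 2, as 1/(n+1) <= 2/(n+2). *)
have wE : weight v n = model c n + cprod ones (fun n => weight v n - model c n) n -
    (if n is m.+1 then cprod ones (fun n => weight v n - model c n) m else 0).
  case: n => [|n]; first by rewrite cprod_ones big_ord1; ring.
  by rewrite cprod_onesS; ring.
rewrite wE; apply: le_trans (ler_normB _ _) _; rewrite mulrDl; apply: lerD.
  apply: le_trans (ler_normD _ _) _; rewrite mulrDl; apply: lerD.
    by have := HD n; rewrite expr0 div1r.
  by have := HC n; rewrite expr0 div1r.
case: n {wE} => [|n]; first by rewrite normr0 mulr_ge0// mulr_ge0.
have := HC n; rewrite expr0 div1r => /le_trans; apply.
rewrite [2 * C]mulrC -mulrA ler_wpM2l//.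
have n0 : 0 < n.+1%:R :> R by rewrite ltr0n.
rewrite ler_pdivlMr ?ltr0n// ler_pdivrMl// -[n.+2%:R]natr1.
have : 1 <= n.+1%:R :> R by rewrite ler1n.
lra.
Qed.

End Mertens.

(** * Newton identities *)

Section Newton.
Variable R : realType.

Lemma cprod_shiftr (f g : nat -> R) k : g 0%N = 0 ->
  cprod f g k.+1 = cprod f (fun i => g i.+1) k.
Proof.
move=> g0; rewrite /cprod big_ord_recr /= subnn g0 mulr0 addr0.
by apply: eq_bigr => i _ /=; rewrite subSn// -ltnS.
Qed.

(** The polynomial 1 + y z. *)
Definition linear_factor (y : R) (i : nat) : R :=
  match i with 0 => 1 | 1 => y | _ => 0 end.

Lemma cprod_linear_factor0 y f : cprod (linear_factor y) f 0 = f 0%N.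
Proof. by rewrite /cprod big_ord1 mul1r. Qed.

Lemma cprod_linear_factorS y f k :
  cprod (linear_factor y) f k.+1 = f k.+1 + y * f k.
Proof.
rewrite /cprod big_ord_recl big_ord_recl /= big1 ?addr0 => [|i _]; last by rewrite mul0r.
by rewrite mul1r subn0 subSS subn0.
Qed.

Section Model.
Variable c : R.

(* The coefficient of z^k in exp(c z) (1 + z) (1 + z/2) ... (1 + z/N). *)
Definition elem_model (k N : nat) : R := cprod ones (cpow (model c) k) N / k`!%:R.

Lemma elem_model0 N : elem_model 0 N = 1.
Proof. by rewrite /elem_model cprodC cprod_delta fact0 divr1. Qed.

(** Raising N multiplies the series in z by 1 + z/(n+1). Since i * [model c i] = 1 for i > 0,
    [cpow_deriv] turns the new coefficient of the power into a partial sum of the previous power. *)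
Lemma elem_modelS k n :
  elem_model k.+1 n.+1 = elem_model k.+1 n + n.+1%:R^-1 * elem_model k n.
Proof.
rewrite /elem_model cprod_onesS mulrDl; congr (_ + _).
have -> : cpow (model c) k.+1 n.+1 = n.+1%:R^-1 * (k.+1%:R * cprod ones (cpow (model c) k) n).
  apply: (mulfI (_ : n.+1%:R != 0)); first by rewrite pnatr_eq0.
  rewrite cpow_deriv mulrA divff ?pnatr_eq0// mul1r; congr (_ * _).
  rewrite cprodC cprod_shiftr ?mul0r// cprodC; apply: cprod_ext => // i _.
  by rewrite /= divff ?pnatr_eq0.
rewrite factS natrM; field.
by rewrite ?natr1 ?nat1r !pnatr_eq0 -?lt0n ?fact_gt0.
Qed.

Lemma elem_modelN0 k : elem_model k 0 = c ^+ k / k`!%:R.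
Proof.
rewrite /elem_model cprod_ones big_ord1; congr (_ / _).
elim: k => [|k IH]; first by rewrite expr0.
by rewrite cpowS /cprod big_ord1 /= -/(cpow _ _) IH exprS.
Qed.

Definition power_sum (j N : nat) : R := \sum_(m < N) m.+1%:R ^- j.

(** The coefficients of the logarithmic derivative c + sum over m <= N of (1/m)/(1 + z/m). *)
Definition newton_coef (N i : nat) : R := c * delta i + (-1) ^+ i * power_sum i.+1 N.

Lemma newton_elem_model k N :
  k.+1%:R * elem_model k.+1 N = cprod (newton_coef N) (elem_model ^~ N) k.
Proof.
elim: N k => [|N IH] k.
  rewrite (@cprod_ext _ _ (fun i => c * delta i) _ (elem_model ^~ 0%N))//; last first.
    by move=> i _; rewrite /newton_coef /power_sum big_ord0 mulr0 addr0.
  rewrite cprodZl cprod_delta !elem_modelN0 factS natrM exprS; field.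
  by rewrite nat1r !pnatr_eq0 -lt0n fact_gt0.
set y : R := N.+1%:R^-1.
(* [G] is the series y/(1 + y z), the logarithmic derivative of the new factor; [LG] below clears
   its denominator. *)
pose G i := y * (- y) ^+ i.
have eE : elem_model ^~ N.+1 = cprod (linear_factor y) (elem_model ^~ N).
  apply/funext => -[|j]; first by rewrite cprod_linear_factor0 !elem_model0.
  by rewrite cprod_linear_factorS elem_modelS.
have SE : newton_coef N.+1 = fun i => newton_coef N i + G i.
  apply/funext => i; rewrite /newton_coef /power_sum big_ord_recr /= mulrDr addrA.
  by congr (_ + _); rewrite -exprVn -/y /G [(- y) ^+ i]exprNn exprS; ring.
have LG : cprod (linear_factor y) G = fun i => y * delta i.
  apply/funext => -[|j]; first by rewrite cprod_linear_factor0 /G expr0.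
  by rewrite cprod_linear_factorS /G /delta /= exprS; ring.
have SNE : cprod (newton_coef N) (elem_model ^~ N) = fun j => j.+1%:R * elem_model j.+1 N.
  by apply/funext => j; rewrite IH.
rewrite eE SE cprodDl !cprodA (cprodC G) LG cprodZl cprod_delta.
rewrite (cprodC (newton_coef N)) -cprodA SNE.
rewrite elem_modelS -/y; case: k => [|k].
  by rewrite cprod_linear_factor0; ring.
rewrite cprod_linear_factorS -[k.+2%:R]natr1; ring.
Qed.

End Model.

(** * The generating series of the limiting polynomials *)

Section Target.
Variables (a : nat -> R) (ha : coef_seq a).

(* The coefficients of exp(- zeta(2) z^2/2 + zeta(3) z^3/3 - ...), which fixes the
   values at 0 and 1 that [coef_seq] leaves free. *)
Definition exp_coef (m : nat) : R :=
  match m with 0 => 1 | 1 => 0 | _ => a m / m`!%:R end.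

(** The derivative of the exponent - zeta(2) z^2/2 + zeta(3) z^3/3 - ... *)
Definition zeta_coef (i : nat) : R := if i is 0 then 0 else (-1) ^+ i * zeta i.+1%:R.

(** The recursion for a_(n+1) divided by n!, since C(n, i) i!/n! = 1/(n-i)!; the first cases check
    the given initial values. *)
Lemma exp_coef_rec n : n.+1%:R * exp_coef n.+1 = cprod zeta_coef exp_coef n.
Proof.
have [a2 a3 a4 a5] := ha.
case: n => [|[|[|[|n]]]]; rewrite /cprod.
- by rewrite big_ord1 /= mulr0 mul0r.
- by rewrite !big_ord_recl big_ord0 /= a2 /bump /= !factS fact0; field.
- by rewrite !big_ord_recl big_ord0 /= /bump /= a3 !factS fact0; field.
- by rewrite !big_ord_recl big_ord0 /= /bump /= a4 a2 !factS fact0; field.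
rewrite /exp_coef a5//.
have f0 k : k`!%:R != 0 :> R by rewrite pnatr_eq0 -lt0n fact_gt0.
rewrite -(big_mkord xpredT (fun i => zeta_coef i * exp_coef (n.+4 - i)%N)).
(* The last term is the isolated zeta value; its neighbour vanishes because [exp_coef 1] is 0, and
   the term i = 0 because [zeta_coef 0] is 0. *)
rewrite [RHS]big_nat_recr//= [X in _ = X + _]big_nat_recr//= subnn subSnn /= mulr0 addr0 mulr1.
rewrite [X in _ = X + _]big_ltn//= mul0r add0r.
rewrite [(n.+1.+4)`!]factS natrM invfM mulrCA [n.+1.+4%:R * _]mulrA divff ?pnatr_eq0// mul1r.
rewrite mulrDl mulr_suml; congr (_ + _); last first.
  by rewrite mulrAC mulfK.
apply: eq_big_nat => i /andP[i1 i2].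
case: i i1 i2 => // i _ i2; rewrite /zeta_coef.
have : (n.+4 - i.+1 = (n.+2 - i.+1).+2)%N by lia.
move=> E; rewrite /exp_coef E -E.
have ii : (i.+1 <= n.+4)%N by lia.
have := @bin_fact n.+4 i.+1 ii => /(congr1 (fun m => m%:R : R)).
rewrite 2!natrM => <-.
field.
by rewrite !f0 pnatr_eq0 -lt0n bin_gt0 ii.
Qed.

(** The coefficient of z^k in exp(T z) times the series of [exp_coef]. *)
Definition target (T : R) (k : nat) : R := cprod exp_coef (fun n => T ^+ n / n`!%:R) k.

Definition target_coef (T : R) (i : nat) : R :=
  if i is 0 then T else (-1) ^+ i * zeta i.+1%:R.

Lemma target0 T : target T 0 = 1.
Proof. by rewrite /target /cprod big_ord1 /= expr0 fact0 divr1 mulr1. Qed.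

(** The product rule, with T and [zeta_coef] as the logarithmic derivatives of the two factors. *)
Lemma target_rec T k : k.+1%:R * target T k.+1 = cprod (target_coef T) (target T) k.
Proof.
have -> : target_coef T = fun i => T * delta i + zeta_coef i.
  by apply/funext => -[|i]; rewrite /delta /= ?mulr1 ?mulr0 ?addr0 ?add0r.
rewrite cprodDl cprodZl cprod_delta.
rewrite /target cprod_deriv addrC; congr (_ + _).
  rewrite cprod_shiftr ?mul0r// !(cprodC exp_coef) -cprodZl; apply: cprod_ext => // i _.
  rewrite factS natrM exprS; field.
  by rewrite nat1r !pnatr_eq0 -lt0n fact_gt0.
rewrite cprodC cprod_shiftr ?mul0r// cprodC.
have -> : (fun i => i.+1%:R * exp_coef i.+1) = cprod zeta_coef exp_coef.
  by apply/funext => i; rewrite exp_coef_rec.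
by rewrite cprodA.
Qed.

Lemma target_expand T k : k`!%:R * target T k =
  T ^+ k + \sum_(2 <= m < k.+1) 'C(k, m)%:R * a m * T ^+ (k - m).
Proof.
have f0 j : j`!%:R != 0 :> R by rewrite pnatr_eq0 -lt0n fact_gt0.
case: k => [|k].
  by rewrite target0 fact0 big_geq// addr0 mulr1.
rewrite /target /cprod -(big_mkord xpredT (fun i => exp_coef i * (T ^+ (k.+1 - i) / (k.+1 - i)`!%:R))).
rewrite big_ltn//= big_ltn//= mul0r add0r mul1r subn0 mulrDr; congr (_ + _).
  by rewrite mulrCA divff ?mulr1.
rewrite mulr_sumr; apply: eq_big_nat => -[|[|m]]// /andP[_ mk].
rewrite ltnS in mk; have := bin_fact mk => /(congr1 (fun m => m%:R : R)).
rewrite 2!natrM => <-; rewrite /exp_coef; move: (f0 m.+2) (f0 (k.+1 - m.+2)%N).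
move: (m.+2`!%:R) ((k.+1 - m.+2)`!%:R) (T ^+ _) ('C(_, _)%:R) => x y t b x0 y0.
by field; rewrite x0 y0.
Qed.

End Target.

(** Stability of the Newton recursion, by strong induction. The error has two parts, from the
    coefficients and from the earlier terms, each at most D l r A^k; A >= 2 D l absorbs both. *)
Lemma newton_compare (S Z e t : nat -> R) (D l r : R) :
  1 <= l -> 0 <= r -> 0 <= D -> e 0%N = 1 -> t 0%N = 1 ->
  (forall i, `|S i| <= D * l) -> (forall i, `|Z i| <= D * l) ->
  (forall i, `|S i - Z i| <= D * l * r) ->
  (forall k, k.+1%:R * e k.+1 = cprod S e k) ->
  (forall k, k.+1%:R * t k.+1 = cprod Z t k) ->
  forall k, `|t k| <= ((1 + 2 * D) * l) ^+ k /\ `|e k - t k| <= r * ((1 + 2 * D) * l) ^+ k.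
Proof.
move=> l1 r0 D0 e0 t0 HS HZ HSZ He Ht.
set A := (1 + 2 * D) * l.
have Dl0 : 0 <= D * l by rewrite mulr_ge0//; lra.
have A1 : 1 <= A by rewrite /A; nra.
have DA : 2 * (D * l) <= A by rewrite /A; lra.
elim/ltn_ind => -[_|k IH].
  by rewrite e0 t0 subrr normr0 normr1 expr0; split; rewrite ?mulr1.
have k0 : 0 < k.+1%:R :> R by rewrite ltr0n.
have Apow (i : 'I_k.+1) : A ^+ (k - i) <= A ^+ k by rewrite ler_weXn2l// leq_subr.
have Ak0 : 0 <= A ^+ k by rewrite exprn_ge0//; lra.
have lt_ (i : 'I_k.+1) : (k - i < k.+1)%N by rewrite ltnS leq_subr.
have sumC (x : R) : \sum_(i < k.+1) x = k.+1%:R * x.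
  by rewrite sumr_const card_ord mulr_natl.
split.
  rewrite -(ler_pM2l k0) -[X in X * `|_|](ger0_norm (ltW k0)) -normrM Ht.
  apply: le_trans (ler_norm_sum _ _ _) _.
  rewrite -sumC; apply: ler_sum => i _; rewrite normrM exprS.
  apply: ler_pM => //; first by apply: le_trans (HZ i) _; lra.
  exact: le_trans (IH _ (lt_ i)).1 (Apow i).
rewrite -(ler_pM2l k0) -[X in X * `|_|](ger0_norm (ltW k0)) -normrM mulrBr Ht He.
rewrite /cprod -sumrB; apply: le_trans (ler_norm_sum _ _ _) _.
rewrite -sumC; apply: ler_sum => i _; have [h1 h2] := IH _ (lt_ i).
have -> : S i * e (k - i)%N - Z i * t (k - i)%N =
  S i * (e (k - i)%N - t (k - i)%N) + (S i - Z i) * t (k - i)%N by ring.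
apply: le_trans (ler_normD _ _) _; rewrite !normrM.
apply: (@le_trans _ _ (D * l * (r * A ^+ k) + D * l * r * A ^+ k)).
  apply: lerD; apply: ler_pM => //.
    by apply: le_trans h2 _; rewrite ler_wpM2l.
  exact: le_trans h1 (Apow i).
rewrite exprS; have : 0 <= r * A ^+ k by rewrite mulr_ge0.
nra.
Qed.

(** Exponents are at least 2, and 1/n^2 <= 2/n - 2/(n+1) telescopes. *)
Lemma zeta_rate i N : `|power_sum i.+2 N - zeta i.+2%:R| <= 2 / N.+1%:R.
Proof.
have [l Hl] : exists l, forall n, `|power_sum i.+2 n - l| <= 2 / n.+1%:R.
  apply: telescope_limit => n; first by rewrite divr_ge0.
  rewrite /power_sum big_ord_recr /= addrAC subrr add0r.
  have x1 : 1 <= n.+1%:R :> R by rewrite ler1n.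
  rewrite ger0_norm ?invr_ge0 ?exprn_ge0//.
  apply: (@le_trans _ _ (n.+1%:R ^- 2)).
    rewrite lef_pV2 ?posrE ?exprn_gt0 ?ltr0n// ler_weXn2l//.
  rewrite -[n.+2%:R]natr1; move: n.+1%:R x1 => x x1.
  rewrite -subr_ge0.
  have -> : 2 / x - 2 / (x + 1) - x ^- 2 = (x - 1) / (x ^+ 2 * (x + 1)).
    by field; rewrite !gt_eqF//; lra.
  by rewrite divr_ge0 ?mulr_ge0 ?exprn_ge0//; lra.
suff -> : zeta i.+2%:R = l by [].
have sE : series (riemannR (i.+2%:R : R)) = power_sum i.+2.
  apply/funext => n; rewrite /series /= /power_sum big_mkord; apply: eq_bigr => m _.
  by rewrite /riemannR powR_mulrn.
rewrite /zeta sE; apply/cvg_lim => //; apply/cvgrPdistC_le => e e0.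
near=> n; apply: le_trans (Hl n) _.
rewrite ler_pdivrMr ?ltr0n// mulrC -ler_pdivrMr//.
apply: ltW; apply: lt_le_trans (truncnS_gt _) _.
by rewrite ler_nat ltnS; near: n; exact: nbhs_infty_ge.
Unshelve. all: by end_near. Qed.

Lemma model_target_rate (a : nat -> R) (ha : coef_seq a) (c K : R) (k : nat) :
  exists C, forall N T, `|T - (c + harm R N)| <= K / N.+1%:R ->
  `|cprod ones (cpow (model c) k.+1) N - k.+1`!%:R * target a T k.+1| <=
    C * (harm R N.+1 ^+ k / N.+1%:R).
Proof.
(* The 5 leaves room for one harmonic number and for the bounds 2 on zeta values and 4 on power
   sums. *)
pose D := `|c| + `|K| + 5.
exists (k.+1`!%:R * (1 + 2 * D) ^+ k.+1) => N T HT.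
set l := harm R N.+1; have l1 : 1 <= l by apply: harm_ge1.
have n0 : 0 < N.+1%:R :> R by rewrite ltr0n.
have i1 : N.+1%:R^-1 <= 1 :> R by rewrite invf_le1// ler1n.
have i0 : 0 <= N.+1%:R^-1 :> R by rewrite invr_ge0.
have HT' : `|T - (c + harm R N)| <= `|K| * N.+1%:R^-1.
  by apply: le_trans HT _; rewrite ler_wpM2r// ler_norm.
have KK : `|K| * N.+1%:R^-1 <= `|K| by rewrite ler_piMr.
have hN : 0 <= harm R N <= l by rewrite harm_ge0 le_harm.
have [c0 K0] := (normr_ge0 c, normr_ge0 K).
have z2 i : `|zeta (i.+2%:R : R)| <= 2.
  have := zeta_rate i 0; rewrite /power_sum big_ord0 sub0r normrN divr1; exact.
have p4 i : `|power_sum i.+2 N| <= 4.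
  rewrite -[power_sum _ _](subrK (zeta i.+2%:R)); apply: le_trans (ler_normD _ _) _.
  rewrite (_ : 4 = 2 + 2 :> R); last by lra.
  by apply: lerD => //; apply: le_trans (zeta_rate i N) _; rewrite ler_piMr.
have s1 i (x : R) : `|(-1) ^+ i * x| = `|x| by rewrite normrM normrX normrN1 expr1n mul1r.
have rl : l * (l * N.+1%:R)^-1 = N.+1%:R^-1.
  by rewrite invfM mulrA divff ?mul1r// gt_eqF//; lra.
(* The choice r = 1/(l (N+1)) fits coefficients that differ by only O(1/N), and cancels one of the
   k+1 factors l. *)
have h : `|elem_model c k.+1 N - target a T k.+1| <=
    (l * N.+1%:R)^-1 * ((1 + 2 * D) * l) ^+ k.+1.
  apply: (proj2 (@newton_compare (newton_coef c N) (target_coef T)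
    (elem_model c ^~ N) (target a T) D l (l * N.+1%:R)^-1 l1
    _ _ (elem_model0 c N) (target0 a T) _ _ _ (newton_elem_model c ^~ N) (target_rec ha T) k.+1)).
  - by rewrite invr_ge0 mulr_ge0//; lra.
  - by rewrite /D; lra.
  - case=> [|i]; rewrite /newton_coef /delta /= ?mulr1 ?mulr0 ?expr0 ?mul1r ?add0r.
      have -> : power_sum 1 N = harm R N by apply: eq_bigr => j _; rewrite expr1.
      apply: le_trans (ler_normD _ _) _; rewrite (ger0_norm (harm_ge0 _ _)) /D.
      nra.
    rewrite s1 (le_trans (p4 i))// /D; nra.
  - case=> [|i] /=.
      rewrite -[T](subrK (c + harm R N)); apply: le_trans (ler_normD _ _) _.
      apply: le_trans (lerD (le_trans HT' KK) (ler_normD _ _)) _.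
      rewrite (ger0_norm (harm_ge0 _ _)) /D; nra.
    rewrite s1 (le_trans (z2 i))// /D; nra.
  - move=> i; rewrite -mulrA rl; case: i => [|i]; rewrite /newton_coef /delta /=.
      rewrite mulr1 expr0 mul1r.
      have -> : power_sum 1 N = harm R N by apply: eq_bigr => j _; rewrite expr1.
      rewrite distrC (le_trans HT')// ler_wpM2r// /D; lra.
    rewrite mulr0 add0r -mulrBr s1 (le_trans (zeta_rate i N))// ler_wpM2r// /D; lra.
rewrite /elem_model in h.
have f0 : 0 < k.+1`!%:R :> R by rewrite ltr0n fact_gt0.
have -> : cprod ones (cpow (model c) k.+1) N - k.+1`!%:R * target a T k.+1 =
  k.+1`!%:R * (cprod ones (cpow (model c) k.+1) N / k.+1`!%:R - target a T k.+1).
  by rewrite mulrBr mulrCA divff ?mulr1// gt_eqF.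
rewrite normrM (ger0_norm (ltW f0)) -mulrA ler_pM2l//.
apply: le_trans h _; rewrite exprMn [l ^+ k.+1]exprS -rl.
move: (l * N.+1%:R)^-1 ((1 + 2 * D) ^+ k.+1) (l ^+ k) => q u v.
by rewrite (_ : q * _ = u * (v * (l * q))); last by ring.
Qed.

End Newton.

(** * Prime tuples *)

Section Tuples.
Variable R : realType.

Lemma big_tupleS (T : finType) k (P : pred (k.+1.-tuple T)) (F : k.+1.-tuple T -> R) :
  \sum_(t | P t) F t =
  \sum_(p : T) \sum_(t : k.-tuple T | P (cons_tuple p t)) F (cons_tuple p t).
Proof.
rewrite pair_big_dep /= (reindex (fun x : T * k.-tuple T => cons_tuple x.1 x.2)) //=.
exists (fun t => (thead t, behead_tuple t)) => [[p t] _|t _] /=.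
  by congr pair; apply/val_inj.
by rewrite [RHS]tuple_eta; apply/val_inj.
Qed.

(** Induction on the length: once the first prime p is fixed, the others have the budget N - v p,
    which is a Cauchy product after grouping by buckets. *)
Lemma sum_prime_tuplesE (v : nat -> nat) k N X : near_ln R v -> (wbound R N <= X)%N ->
  \sum_(t : k.-tuple 'I_X | all prime (map val t) && (\sum_(q <- map val t) v q <= N)%N)
    ((\prod_(q <- map val t) q)%N%:R : R)^-1 =
  cprod ones (cpow (weight R v) k) N.
Proof.
move=> nv; elim: k N => [|k IH] N NX.
  rewrite cprodC cprod_delta (big_pred1 [tuple]) /= ?big_nil ?invr1//.
  by move=> t; rewrite [t]tuple0 /= big_nil eqxx.
have -> : cprod ones (cpow (weight R v) k.+1) =
    cprod (weight R v) (cprod ones (cpow (weight R v) k)).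
  by rewrite cpowS !cprodA (cprodC ones).
rewrite big_tupleS.
rewrite {1}/cprod -(@weight_partition _ v N X (fun u => cprod ones _ (N - u)%N))//.
rewrite big_mkord [RHS]big_mkcond; apply: eq_bigr => p _ /=.
have [pp|pp] := boolP (prime p); last by rewrite big_pred0_eq.
have [vN|vN] /= := leqP (v p) N; last first.
  rewrite big_pred0// => t; rewrite big_cons; apply/negP => /andP[_]; lia.
rewrite -IH; last by apply: leq_trans NX; apply: leq_wbound; apply: leq_subr.
rewrite mulr_sumr; apply: eq_big => [t|t _]; last by rewrite big_cons natrM invfM.
by rewrite big_cons leq_subRL.
Qed.

Definition flog (p : nat) : nat := Num.truncn (ln (p%:R : R)).

Lemma flog_bounds p : prime p -> (flog p)%:R <= ln (p%:R : R) <= (flog p).+1%:R.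
Proof.
by move=> pp; have /andP[-> /ltW->] := truncn_itv (ln_nat_ge0 R p).
Qed.

Lemma near_ln_flog : near_ln R flog.
Proof. by move=> p /flog_bounds /andP[h1 h2]; split=> //; lra. Qed.

Lemma near_ln_flogS : near_ln R (fun p => (flog p).+1).
Proof.
move=> p /flog_bounds /andP[h1 h2]; rewrite -[(flog p).+2%:R]natr1 -[(flog p).+1%:R]natr1.
by move: h2; rewrite -[(flog p).+1%:R]natr1; split; lra.
Qed.

Lemma ln_prod_flog (s : seq nat) : all prime s ->
  (\sum_(q <- s) flog q)%N%:R <= ln ((\prod_(q <- s) q)%N%:R : R) <=
  (\sum_(q <- s) (flog q).+1)%N%:R.
Proof.
elim: s => [|q s IH] /=; first by rewrite !big_nil ln1 lexx.
move=> /andP[qp sp]; rewrite !big_cons !natrD natrM.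
have q0 : 0 < q%:R :> R by rewrite ltr0n prime_gt0.
have s0 : 0 < (\prod_(q <- s) q)%N%:R :> R.
  by rewrite ltr0n big_seq prodn_cond_gt0// => p /(allP sp) /prime_gt0.
rewrite lnM ?posrE//; have /andP[h1 h2] := flog_bounds qp.
by have /andP[h3 h4] := IH sp; rewrite !lerD.
Qed.

(** Each prime of a tuple divides the product, hence is at most [x]; the sum can therefore run over
    tuples from a finite type. *)
Lemma prime_tuple_sumE k (x : R) X : (forall q, q%:R <= x -> (q < X.+1)%N) ->
  prime_tuple_sum k x =
  \sum_(t : k.-tuple 'I_X.+1 | all prime (map val t) && ((\prod_(q <- map val t) q)%N%:R <= x))
    ((\prod_(q <- map val t) q)%N%:R : R)^-1.
Proof.
move=> xX; rewrite /prime_tuple_sum.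
pose P := [pred p : k.-tuple nat | all prime p && ((\prod_(q <- p) q)%N%:R <= x)].
have -> : @prime_tuples R k x = [set` P].
  by apply/seteqP; split=> p /=; [move=> [pp px]; rewrite inE pp|rewrite inE => /andP[]].
pose r := [seq map_tuple val t | t : k.-tuple 'I_X.+1].
have inj_val : injective (@map_tuple k 'I_X.+1 nat val).
  by move=> s t /(congr1 val) /= /(inj_map val_inj) /val_inj.
rewrite -(@bigfs _ _ _ _ r); last 2 first.
- by rewrite map_inj_uniq// enum_uniq.
- move=> p /andP[/allP pp px] /negP[].
  have P0 : (0 < \prod_(q <- p) q)%N.
    by rewrite big_seq prodn_cond_gt0// => q /pp /prime_gt0.
  have small q : q \in tval p -> (q < X.+1)%N.
    move=> qp; apply: xX; apply: le_trans px.
    by rewrite ler_nat dvdn_leq// (big_rem q)//= dvdn_mulr.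
  apply/mapP; exists (map_tuple (@inord _) p); first by rewrite mem_enum.
  apply/val_inj => /=; rewrite -map_comp -[LHS]map_id.
  by apply/eq_in_map => q qp /=; rewrite inordK// small.
by rewrite big_map big_enum_cond.
Qed.

(** Rounding up, a sum of at most N forces the product below [x]; rounding down, a product up to [x]
    forces an integer sum below N + 1. *)
Lemma prime_tuple_sum_sandwich k (x : R) : 1 <= x ->
  cprod ones (cpow (weight R (fun p => (flog p).+1)) k) (Num.truncn (ln x)) <=
    prime_tuple_sum k x <=
  cprod ones (cpow (weight R flog) k) (Num.truncn (ln x)).
Proof.
move=> x1; set N := Num.truncn (ln x); have x0 : 0 < x by lra.
have /andP[Nx xN] := truncn_itv (ln_ge0 x1).
have xX q : q%:R <= x -> (q < wbound R N)%N.
  move=> qx; rewrite ltnS truncn_ge_nat ?expR_ge0// (le_trans qx)//.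
  by rewrite -[leLHS]lnK ?posrE// ler_expR ltW.
rewrite (prime_tuple_sumE _ xX) -/(wbound R N).
rewrite -(sum_prime_tuplesE _ near_ln_flog (leqnn _)).
rewrite -(sum_prime_tuplesE _ near_ln_flogS (leqnn _)).
have prod0 (s : seq nat) : all prime s -> 0 < (\prod_(q <- s) q)%N%:R :> R.
  by move=> /allP sp; rewrite ltr0n big_seq prodn_cond_gt0// => p /sp /prime_gt0.
apply/andP; split; rewrite [leLHS]big_mkcond [leRHS]big_mkcond /=; apply: ler_sum => t _.
  have [tp/=|//] := boolP (all _ _); have /andP[h1 h2] := ln_prod_flog tp.
  case: ifP => [tN|_]; last by case: ifP => // _; rewrite invr_ge0.
  rewrite ifT// -ler_ln ?posrE ?prod0//.
  by apply: le_trans h2 (le_trans _ Nx); rewrite ler_nat.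
have [tp/=|//] := boolP (all _ _); have /andP[h1 h2] := ln_prod_flog tp.
case: ifP => [tx|_]; last by case: ifP => // _; rewrite invr_ge0.
rewrite ifT// -ltnS -(ltr_nat R); apply: le_lt_trans h1 (le_lt_trans _ xN).
by rewrite ler_ln ?posrE ?prod0.
Qed.

Lemma harm_le_ln n : harm R n.+1 <= 1 + ln n.+1%:R.
Proof.
elim: n => [|n IH]; first by rewrite /harm big_ord1 ln1 invr1 addr0.
rewrite harmS; have := ln_succ_sub_ge R n; move: IH.
by move: (ln n.+1%:R) (ln n.+2%:R) n.+2%:R^-1 => u v w; lra.
Qed.

End Tuples.

(** * From the index N = floor(log x) back to x *)

Theorem theorem1p4 (R : realType) (a : nat -> R) (ha : coef_seq a)
    (k : nat) (hk : (0 < k)%N) :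
  (fun x : R => prime_tuple_sum k x) =
  (fun x : R =>
     (log2 x + mertens_B R) ^+ k +
     \sum_(2 <= m < k.+1)
        'C(k, m)%:R * a m * (log2 x + mertens_B R) ^+ (k - m))
  +O_ (+oo) (fun x : R => log2 x ^+ k.-1 / ln x).
Proof.
case: k hk => // k _.
have [c [[K HK] Hw]] := weight_model_rate R.
have rate v : near_ln R v -> exists C, forall n,
   `|cprod ones (cpow (weight R v) k.+1) n - cprod ones (cpow (model c) k.+1) n| <=
   C * (harm R n.+1 ^+ k / n.+1%:R).
  move=> /Hw[gw gd]; exact: (growth_cpowB k gw (growth_model c) gd).
have [C1 HC1] := rate _ (near_ln_flog R); have [C2 HC2] := rate _ (near_ln_flogS R).
have [C3 HC3] := model_target_rate ha c (K + 2) k.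
have C10 := growth_const_ge0 HC1; have C20 := growth_const_ge0 HC2.
apply/eqaddOP; apply/bigO_exP.
(* [C1] and [C2] come from the two roundings, [C3] from the model against the target; the 1 ensures
   positivity, and 3 comes from [harm] <= 2 + log_2 x <= 3 log_2 x. *)
exists ((C1 + C2 + `|C3| + 1) * 3 ^+ k).
  by rewrite mulr_gt0 ?exprn_gt0//; have := normr_ge0 C3; lra.
near=> x.
(* Beyond e^e one has log_2 x >= 1. *)
have xe : expR (expR 1) <= x by near: x; apply: nbhs_pinfty_ge; rewrite num_real.
have x1 : 1 <= x by apply: le_trans xe; rewrite -expR0 ler_expR expR_ge0.
have x0 : 0 < x by lra.
have lnx : expR 1 <= ln x by rewrite -[leLHS]expRK ler_ln ?posrE ?expR_gt0.
have lx0 : 0 < ln x by apply: lt_le_trans lnx; rewrite expR_gt0.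
have lx1 : 1 <= ln x by apply: le_trans lnx; rewrite -expR0 ler_expR.
have l2x : 1 <= log2 x by rewrite -[leLHS]expRK ler_ln ?posrE ?expR_gt0.
have /andP[lo hi] := prime_tuple_sum_sandwich k.+1 x1.
have /andP[Nx xN] := truncn_itv (ltW lx0).
set N := Num.truncn (ln x) in lo hi Nx xN.
have N1 : (0 < N)%N by rewrite truncn_gt0.
have n0 : 0 < N.+1%:R :> R by rewrite ltr0n.
pose T := log2 x + mertens_B R.
rewrite /= -[(_ - _) x]/(prime_tuple_sum k.+1 x - (T ^+ k.+1 +
  \sum_(2 <= m < k.+2) 'C(k.+1, m)%:R * a m * T ^+ (k.+1 - m))) -target_expand.
(* Replacing ln(N+1) by log_2 x costs at most 1/ln x <= 2/(N+1), which is the 2 added to [K]. *)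
have HT : `|T - (c + harm R N)| <= (K + 2) / N.+1%:R.
  have h1 : `|log2 x - ln N.+1%:R| <= 2 / N.+1%:R.
    have h : ln N.+1%:R - log2 x <= (ln x)^-1.
      apply: le_trans (ln_sub_le _ _) _ => //; rewrite ler_pdivrMr// mulVf ?gt_eqF//.
      by move: Nx; rewrite -[N.+1%:R]natr1; lra.
    have h' : log2 x <= ln N.+1%:R by rewrite ler_ln ?posrE// ltW.
    rewrite distrC ger0_norm ?subr_ge0//; apply: le_trans h _.
    rewrite ler_pdivlMr// ler_pdivrMl// -[N.+1%:R]natr1.
    by lra.
  have := HK N; rewrite expr0 div1r => h2.
  rewrite (_ : T - _ = (log2 x - ln N.+1%:R) - (c + harm R N - ln N.+1%:R - mertens_B R)).
    by apply: le_trans (ler_normB _ _) _; rewrite [K + 2]addrC mulrDl lerD.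
  by rewrite /T; ring.
have H3 := HC3 N T HT.
set rho := harm R N.+1 ^+ k / N.+1%:R in H3.
have rho0 : 0 <= rho by apply: growth_rate_ge0.
have main : `|prime_tuple_sum k.+1 x - k.+1`!%:R * target a T k.+1| <=
    (C1 + C2 + `|C3| + 1) * rho.
  have := HC1 N; have := HC2 N; rewrite -/rho.
  have : C3 * rho <= `|C3| * rho by rewrite ler_wpM2r// ler_norm.
  have : 0 <= C1 * rho by rewrite mulr_ge0.
  have : 0 <= C2 * rho by rewrite mulr_ge0.
  move: H3 lo hi; move: (cprod _ _ _) (cprod _ _ _) (cprod _ _ _) => U V W.
  rewrite !ler_norml => /andP[a1 a2] lo hi b1 b2 b3 /andP[d1 d2] /andP[e1 e2].
  by apply/andP; split; lra.
apply: le_trans main _; rewrite -mulrA ler_wpM2l//.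
  by have := normr_ge0 C3; lra.
rewrite ger0_norm ?divr_ge0 ?exprn_ge0 ?(ltW lx0)//; last by lra.
rewrite mulrA -exprMn; apply: ler_pM => //.
- by rewrite exprn_ge0// harm_ge0.
- rewrite lerXn2r ?nnegrE ?harm_ge0//; first by lra.
  apply: le_trans (harm_le_ln R N) _.
  have h : ln N.+1%:R - log2 x <= 1.
    apply: le_trans (ln_sub_le _ _) _ => //; rewrite ler_pdivrMr// mul1r.
    by move: Nx; rewrite -[N.+1%:R]natr1; lra.
  lra.
- by rewrite lef_pV2 ?posrE// ltW.
Unshelve. all: by end_near. Qed.
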